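(* Let $t$ be an integer with $2\leq t\ll k$ (i.e. $t/k\to 0$). Let $s=s(n)$ and $k=k(n)$ be positive integers and $p=p(n)$ a real number such that (i) $\frac{8(t+1)k^{t+1}s^t\log n}{\binom{n-1}{k-1}}\le p\le 1$, and (ii) $56k^{2+1/t}s \leq n\leq 56k^{2+1/(t-1)}s$. Then with high probability (i.e. with probability tending to $1$ as $n\to\infty$), every non-trivial $\mathcal{F}\subseteq \mathcal{K}_p(n,k)$ with $\nu(\mathcal{F})\leq s$ satisfies $$|\mathcal{F}|< |\mathcal{K}_p(\hat{S})|$$ for some $S\in \binom{[n]}{s}$.
   Context: $\mathcal{K}_p(n,k)$ denotes the Erdős–Rényi random $k$-uniform hypergraph on vertex set $[n]$, each $k$-subset of $[n]$ being an edge independently with probability $p$. For a $k$-graph $\mathcal{F}$, $\nu(\mathcal{F})$ is the maximum number of pairwise disjoint edges, $\tau(\mathcal{F})$ is the minimum size of a vertex set meeting every edge; $\mathcal{F}$ is trivial if $\nu(\mathcal{F})=\tau(\mathcal{F})$ and non-trivial otherwise. For $S\subseteq[n]$, $\mathcal{K}_p(\hat{S})=\{E\in\mathcal{K}_p(n,k)\colon E\cap S\neq\emptyset\}$. $\log$ is the natural logarithm. *)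

(* Defs.v *)
From mathcomp Require Import all_boot all_order all_algebra.

Set Implicit Arguments.
Unset Strict Implicit.
Unset Printing Implicit Defensive.

Import GRing.Theory.

Local Open Scope ring_scope.

Section Hypergraphs.
Variable V : finType.
Implicit Types (F M : {set {set V}}) (S T : {set V}).

Definition complete_hypergraph (k : nat) : {set {set V}} :=
  [set E : {set V} | #|E| == k].

Definition matching_number F : nat :=
  (\max_(M : {set {set V}} | (M \subset F) && trivIset M) #|M|)%N.

Definition is_cover F T : bool := [forall E in F, E :&: T != set0].

(* If F has an empty edge then no cover exists and the value is the default
   #|V|; this cannot occur for k-uniform F with k > 0. *)
Definition cover_number F : nat :=
  #|[arg min_(T < [set: V] | is_cover F T) #|T|]|.

Definition nontrivial F : bool := matching_number F != cover_number F.

Definition edges_meeting F S : {set {set V}} :=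
  [set E in F | E :&: S != set0].

End Hypergraphs.

(* The law of K_p(n,k), as the product measure on the subsets of the set of
   all k-subsets of 'I_n. *)
Definition Kp_weight (R : comNzRingType) (n k : nat) (p : R)
    (G : {set {set 'I_n}}) : R :=
  \prod_(E in complete_hypergraph 'I_n k) (if E \in G then p else 1 - p).

Definition Kp_prob (R : comNzRingType) (n k : nat) (p : R)
    (A : pred {set {set 'I_n}}) : R :=
  \sum_(G : {set {set 'I_n}} | (G \subset complete_hypergraph 'I_n k) && A G)
    Kp_weight k p G.

Lemma sum_subset_prod (R : comNzRingType) (I : finType) (U : {set I})
    (f g : I -> R) :
  \sum_(J : {set I} | J \subset U) \prod_(i in U) (if i \in J then f i else g i)
  = \prod_(i in U) (f i + g i).
Proof.
pose f' i := if i \in U then f i else 0.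
pose g' i := if i \in U then g i else 1.
have -> : \prod_(i in U) (f i + g i) = \prod_i (f' i + g' i).
  rewrite big_mkcond /=; apply: eq_bigr => i _; rewrite /f' /g'.
  by case: ifP => // _; rewrite add0r.
rewrite bigA_distr big_mkcond /=; apply: eq_bigr => J _.
case: ifPn => [sJU|/subsetPn[i iJ iU]].
  rewrite big_mkcond /=; apply: eq_bigr => i _; rewrite /f' /g'.
  case: ifPn => // iU; case: ifP => // iJ.
  by rewrite (subsetP sJU _ iJ) in iU.
by rewrite (bigD1 i) //= iJ /f' (negbTE iU) mul0r.
Qed.

Lemma Kp_prob_total (R : comNzRingType) (n k : nat) (p : R) :
  Kp_prob k p (fun _ : {set {set 'I_n}} => true) = 1.
Proof.
rewrite /Kp_prob; under eq_bigl do rewrite andbT.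
rewrite sum_subset_prod big1 // => E _.
by rewrite addrCA subrr addr0.
Qed.

(* Each k-subset is an edge with probability p, and these events are
   mutually independent. *)
Lemma Kp_prob_superset (R : comNzRingType) (n k : nat) (p : R)
    (A : {set {set 'I_n}}) :
  A \subset complete_hypergraph 'I_n k ->
  Kp_prob k p (fun G => A \subset G) = p ^+ #|A|.
Proof.
move=> sAU; set U := complete_hypergraph _ _ in sAU *.
pose g E : R := if E \in A then 0 else 1 - p.
transitivity (\sum_(G : {set {set 'I_n}} | G \subset U)
    \prod_(E in U) (if E \in G then p else g E)).
  rewrite /Kp_prob big_mkcondr /=; apply: eq_bigr => G _.
  case: ifPn => [sAG|/subsetPn[E EA EG]].
    apply: eq_bigr => E _; case: ifPn => // EG; rewrite /g ifN //.
    by apply: contra EG; apply: (subsetP sAG).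
  by rewrite (bigD1 E) ?(subsetP sAU) //= (negbTE EG) /g EA mul0r.
rewrite sum_subset_prod -prodr_const big_mkcond [RHS]big_mkcond /=.
apply: eq_bigr => E _; rewrite /g.
case: (boolP (E \in A)) => EA; first by rewrite (subsetP sAU) // addr0.
by case: ifP => // _; rewrite addrCA subrr addr0.
Qed.

(* Main.v *)
Require Import Defs.
From mathcomp Require Import all_boot all_order all_algebra.

Set Implicit Arguments.
Unset Strict Implicit.
Unset Printing Implicit Defensive.

(** Let nu(F) <= s. Call a set A robust for F if no k s vertices outside A meet
    all edges of F containing A. Pairwise disjoint robust sets extend greedily to
    pairwise disjoint edges, so there are at most s of them; in particular the set
    T of robust vertices has at most s elements. If F has no cover of size s, then
    #|T| < s, and the edges missing T are few: each contains a minimal robust set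
    of some size i <= t, or has no robust subset of size at most t. Disjoint
    minimal robust i-sets number at most r = s - #|T|, and a non-robust set has at
    most k s relevant one-vertex extensions, so the edges missing T number at most
    r (sum_(2 <= i <= t) i (ks)^(i-1) D_i + k (ks)^t D_(t+1)), where D_i is the
    largest degree of an i-set. Whp D_i <= 3 mu_i + 2 i log n and all vertex degrees
    are at least (2/5) mu_1, where mu_i is the mean; then the bracket is smaller
    than what each vertex added to T gains, and enlarging T to S with #|S| = s wins.
    If F has a cover S of size s, equality #|F| = #|K_p(S^)| would force
    F = K_p(S^), in which all vertices of S are robust, so that nu(F) = tau(F). *)

(** * Robust sets *)

Section RobustSets.
Variable V : finType.
Implicit Types (F G : {set {set V}}) (A B E S T U W : {set V}).

Definition degree G A : nat := #|[set E in G | A \subset E]|.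

(* A set that no m vertices outside it can block: robust sets serve as
   substitutes for edges when building matchings. *)
Definition robust F (m : nat) A : bool :=
  [forall W : {set V}, (#|W| <= m) && [disjoint W & A] ==>
    [exists E in F, (A \subset E) && [disjoint E & W]]].

Lemma robustP F m A :
  reflect (forall W, #|W| <= m -> [disjoint W & A] ->
             exists E, [/\ E \in F, A \subset E & [disjoint E & W]])
          (robust F m A).
Proof.
apply: (iffP forallP) => [rA W Wm WA | rA W].
  have /implyP := rA W; rewrite Wm WA => /(_ isT) /exists_inP[E EF /andP[AE EW]].
  by exists E.
apply/implyP => /andP[Wm WA]; have [E [EF AE EW]] := rA W Wm WA.
by apply/exists_inP; exists E; rewrite ?AE.
Qed.

Lemma robust_edge F m E : E \in F -> robust F m E.
Proof. by move=> EF; apply/robustP => W _ WE; exists E; rewrite disjoint_sym. Qed.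

(** A robust [B] containing [A] but missing the blocking set [W] would lie in an edge that contains
    [A] and avoids [W]. *)
Lemma not_robust_witness F m A : ~~ robust F m A ->
  exists W, [/\ #|W| <= m, [disjoint W & A]
    & forall B, robust F m B -> A \subset B -> ~~ [disjoint B & W]].
Proof.
case/forallPn => W; rewrite negb_imply => /andP[/andP[Wm WA] noE].
exists W; split=> // B /robustP rB AB; apply/negP => BW.
have [||E [EF BE EW]] := rB W => //; first by rewrite disjoint_sym.
case/negP: noE; apply/exists_inP; exists E => //.
by rewrite EW (subset_trans AB BE).
Qed.

Definition disj A B : bool := [disjoint A & B].

Lemma disj_sym : symmetric disj.
Proof. by move=> A B; apply: disjoint_sym. Qed.

Lemma pairwise_disj_set1 S : pairwise disj [seq [set x] | x in S].
Proof.
rewrite pairwise_map; have := enum_uniq (mem S); rewrite uniq_pairwise.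
apply: sub_pairwise => x y nxy; rewrite /disj /= -setI_eq0.
by apply/eqP/setP => z; rewrite !inE; case: eqP => // ->; apply: negbTE.
Qed.

(** Matchings are built as sequences; nonempty pairwise disjoint entries are distinct, so the length
    is the cardinality of a set of edges. *)
Lemma size_le_matching_number F (Ms : seq {set V}) :
  {in Ms, forall E, E \in F /\ E != set0} -> pairwise disj Ms ->
  size Ms <= matching_number F.
Proof.
move=> MF dM; pose r A B := (A != B) && disj A B.
have dM' : pairwise r Ms.
  elim: Ms MF dM => //= A Ms IH MF /andP[/allP dA dM].
  rewrite IH ?andbT //; last by move=> E EM; apply: MF; rewrite inE EM orbT.
  apply/allP => B BM; rewrite /r dA // andbT.
  have [_] := MF A (mem_head _ _); apply: contraNneq => eAB.
  by have := dA B BM; rewrite -eAB /disj -setI_eq0 setIid.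
have uM : uniq Ms by apply: pairwise_uniq dM' => A; rewrite /r eqxx.
have <- : #|[set E in Ms]| = size Ms by rewrite cardsE; apply/card_uniqP.
apply: (leq_bigmax_cond (F := fun M : {set {set V}} => #|M|)).
apply/andP; split; first by apply/subsetP => E; rewrite inE => /MF[].
apply/trivIsetP => A B; rewrite !inE.
elim: Ms {MF dM uM} dM' => //= C Ms IH /andP[/allP rC dM].
rewrite !inE => /predU1P[->|AM] /predU1P[->|BM] //.
- by rewrite eqxx.
- by move=> _; have /andP[] := rC B BM.
- by move=> _; have /andP[_] := rC A AM; rewrite disj_sym.
- exact: IH.
Qed.

Lemma card_bigcup_le (I : Type) (T : finType) (r : seq I) (P : pred I)
    (X : I -> {set T}) :
  #|\bigcup_(i <- r | P i) X i| <= \sum_(i <- r | P i) #|X i|.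
Proof.
elim/big_rec2: _ => [|i m A _ Am]; first by rewrite cards0.
by rewrite (leq_trans (leq_card_setU _ _)) // leq_add2l.
Qed.

(** Induction on [Bs]: its head is replaced by an edge that contains it and avoids the union [W] of
    all other sets. This edge joins [Ms], so the total number of sets stays fixed; the predecessor
    appears because the replaced set itself need not be avoided. *)
Lemma robust_matching F m k (Bs Ms : seq {set V}) :
  {in F, forall E, #|E| = k} ->
  {in Bs, forall B, robust F m B && (#|B| <= k)} ->
  {subset Ms <= F} -> pairwise disj (Bs ++ Ms) ->
  k * (size Bs + size Ms).-1 <= m ->
  exists Ms', [/\ {subset Ms' <= F}, pairwise disj Ms'
    & size Ms' = size Bs + size Ms].
Proof.
move=> Fk; elim: Bs Ms => [|B Bs IH] Ms rB MF dM km; first by exists Ms.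
pose W := \bigcup_(C <- Bs ++ Ms) C.
have /andP[/robustP rBB Bk] := rB B (mem_head _ _).
move: dM => /= /andP[/allP dB dM].
have Wm : #|W| <= m.
  apply: leq_trans km; rewrite /= -size_cat.
  apply: leq_trans (card_bigcup_le _ _ _) _.
  rewrite -sum1_size big_distrr /= !big_seq; apply: leq_sum => C.
  rewrite muln1 mem_cat => /orP[CB|/MF/Fk->//].
  by have /andP[] := rB C (mem_behead (s := B :: Bs) CB).
have WP A : (forall C, C \in Bs ++ Ms -> [disjoint A & C]) -> [disjoint A & W].
  move=> dA; rewrite /W big_seq; elim/big_rec: _ => [|C X /dA dC dX].
    by rewrite disjoint_sym disjoint_subset; apply/subsetP => x; rewrite inE.
  by rewrite disjoint_sym -setI_eq0 setIUl setU_eq0 !setI_eq0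
    ![[disjoint _ & A]]disjoint_sym dC.
have [||E [EF BE EW]] := rBB W => //; first by rewrite disjoint_sym WP.
have dE C : C \in Bs ++ Ms -> [disjoint E & C].
  move=> CB; apply: disjointWr EW; rewrite /W (big_rem C) //=; exact: subsetUl.
have [| |||Ms' [sM' dM' szM']] := IH (E :: Ms).
- by move=> C CB; apply: rB; rewrite inE CB orbT.
- by move=> C; rewrite inE => /predU1P[->|/MF].
- move: dM; rewrite !pairwise_cat allrel_consr /= => /and3P[-> -> ->].
  rewrite !andbT; apply/andP; split; apply/allP => C CB /=.
    by rewrite disj_sym; apply: dE; rewrite mem_cat CB.
  by apply: dE; rewrite mem_cat CB orbT.
- by move: km; rewrite /= addnS.
by exists Ms'; rewrite szM' addSn addnS.
Qed.

(** On a matching, intersecting with [T] is injective and yields disjoint nonempty subsets of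
    [T]. *)
Lemma matching_number_le_cover F T :
  is_cover F T -> matching_number F <= #|T|.
Proof.
move=> /forall_inP cT; apply/bigmax_leqP => M /andP[/subsetP MF dM].
have dM' : trivIset [set E :&: T | E in M].
  apply/trivIsetP => _ _ /imsetP[A AM ->] /imsetP[B BM ->] neq.
  have nAB : A != B by apply: contraNneq neq => ->.
  apply: disjointWl (subsetIl _ _) _; apply: disjointWr (subsetIl _ _) _.
  exact: (trivIsetP dM).
have injM : {in M &, injective (fun E => E :&: T)}.
  move=> A B AM BM eAB; apply/eqP; apply: contraTT (cT A (MF A AM)) => nAB.
  rewrite negbK -subset0; have := trivIsetP dM A B AM BM nAB.
  rewrite -setI_eq0 => /eqP <-; rewrite subsetI subsetIl eAB; exact: subsetIl.
rewrite -(card_in_imset injM).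
have : cover [set E :&: T | E in M] \subset T.
  by apply/bigcupsP => _ /imsetP[A _ ->]; apply: subsetIr.
move/subset_leq_card; apply: leq_trans.
have [_] := leq_card_cover [set E :&: T | E in M]; rewrite dM' => /eqP->.
rewrite -sum1_card; apply: leq_sum => _ /imsetP[A AM ->].
by rewrite card_gt0 cT ?MF.
Qed.

Lemma cover_number_le F T : is_cover F T -> cover_number F <= #|T|.
Proof.
move=> cT; rewrite /cover_number.
(* If the default [setT] fails to cover, [F] has an empty edge, and [T] cannot cover it either. *)
case: (boolP (is_cover F setT)) => [c0|nc]; first by case: arg_minnP => // U _; apply.
case/forall_inPn: nc => E EF; rewrite setIT negbK => /eqP E0.
by have := forall_inP cT E EF; rewrite E0 set0I eqxx.
Qed.

Lemma matching_number_le_cover_number F T :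
  is_cover F T -> matching_number F <= cover_number F.
Proof.
move=> cT; apply: matching_number_le_cover; rewrite /cover_number.
case: arg_minnP => //; apply/forall_inP => E EF; rewrite setIT.
by apply: contraNneq (forall_inP cT E EF) => ->; rewrite set0I.
Qed.

(** * Edges away from the robust vertices when the matching number is bounded *)

Section BoundedMatching.
Variables (F : {set {set V}}) (k s : nat).
Hypotheses (k_gt0 : 0 < k) (Fk : {in F, forall E, #|E| = k})
  (nuF : matching_number F <= s).
Let m := k * s.
Let rob := robust F m.

Lemma robust_family_size (Bs : seq {set V}) :
  {in Bs, forall B, rob B && (#|B| <= k)} -> pairwise disj Bs -> size Bs <= s.
Proof.
move=> rB dB; rewrite leqNgt; apply/negP => ltsB.
(* Among [s.+1] sets, each replacement avoids [s] others, hence at most [k * s = m] vertices. *)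
have [||||Ms [MF dM szM]] := @robust_matching F m k (take s.+1 Bs) [::] Fk.
- by move=> B /mem_take /rB.
- by [].
- by rewrite cats0; apply: subseq_pairwise dB; apply: take_subseq.
- by rewrite addn0 size_takel.
have MF' : {in Ms, forall E, E \in F /\ E != set0}.
  by move=> E /MF EF; split=> //; rewrite -card_gt0 (Fk EF).
have := leq_trans (size_le_matching_number MF' dM) nuF.
by rewrite szM addn0 size_takel // ltnn.
Qed.

Definition robust_vertices : {set V} := [set x | rob [set x]].

(** Singletons of robust vertices are robust sets too, and join [M] in one disjoint family. *)
Lemma robust_family_card (M : {set {set V}}) : trivIset M ->
  {in M, forall B, [/\ rob B, #|B| <= k & [disjoint B & robust_vertices]]} ->
  #|M| + #|robust_vertices| <= s.
Proof.
move=> dM rM; pose Ts := [seq [set x] | x in robust_vertices].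
have := @robust_family_size (enum M ++ Ts).
rewrite size_cat size_map -!cardE; apply.
  move=> B; rewrite mem_cat mem_enum => /orP[/rM[-> ->]//|/mapP[x]].
  by rewrite mem_enum inE => rx ->; rewrite rx cards1.
rewrite pairwise_cat; apply/and3P; split.
- apply/allrelP => B C; rewrite mem_enum => /rM[_ _ dB] /mapP[x].
  rewrite mem_enum => xT ->; apply: disjointWr dB.
  by rewrite sub1set.
- have := enum_uniq (mem M); rewrite uniq_pairwise.
  apply: (@sub_in_pairwise _ (mem M)) => [A B AM BM nAB|].
    exact: (trivIsetP dM).
  by apply/allP => A; rewrite mem_enum.
- exact: pairwise_disj_set1.
Qed.

Lemma card_robust_vertices_le : #|robust_vertices| <= s.
Proof.
have := @robust_family_card set0; rewrite cards0; apply => [|B].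
  by apply/trivIsetP => A; rewrite inE.
by rewrite inE.
Qed.

(** A maximal disjoint subfamily [M] of [H] has at most [s - #|robust_vertices|] members, and by
    maximality its union meets every member of [H]. *)
Lemma robust_transversal h (H : {set {set V}}) : h <= k ->
  {in H, forall B, [/\ rob B, B != set0, #|B| <= h & [disjoint B & robust_vertices]]} ->
  exists2 U : {set V}, #|U| <= h * (s - #|robust_vertices|)
    & {in H, forall B, ~~ [disjoint B & U]}.
Proof.
move=> hk rH; pose P (M : {set {set V}}) := (M \subset H) && trivIset M.
have P0 : P set0 by rewrite /P sub0set; apply/trivIsetP => A; rewrite inE.
have [M /maxsetP[/andP[/subsetP MH dM] Mmax] _] := maxset_exists P0.
exists (cover M) => [|B BH]; last first.
  apply/negP => dB.
  have [||dBM BM] := @trivIsetU1 _ B M _ dM.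
  - move=> C CM; apply: disjointWr dB; exact: bigcup_sup CM.
  - by apply/negP => /MH/rH[_]; rewrite eqxx.
  case/negP: BM; have <- : B |: M = M; last exact: setU11.
  apply: Mmax; last exact: subsetUr.
  by rewrite /P dBM andbT subUset sub1set BH; apply/subsetP.
have Ms : #|M| <= s - #|robust_vertices|.
  rewrite leq_subRL ?card_robust_vertices_le // addnC; apply: robust_family_card => // B.
  by move=> /MH/rH[rB _ Bh dB]; split=> //; apply: leq_trans hk.
have [/leq_trans le_sum _] := leq_card_cover M; apply: le_sum.
rewrite mulnC; apply: leq_trans (leq_mul Ms (leqnn h)).
by rewrite -sum_nat_const; apply: leq_sum => A /MH/rH[].
Qed.

(* A non-robust set A has a blocking set of at most m vertices, which every
   robust superset of A must hit; so A is extended in at most m ways. *)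
Lemma branching (H : {set {set V}}) (U : {set V}) j :
  {in H, forall B, ~~ [disjoint B & U]} ->
  {in H, forall B, rob B /\
    (forall A, A \subset B -> A != set0 -> #|A| <= j -> ~~ rob A)} ->
  exists C : {set {set V}}, [/\ #|C| <= #|U| * m ^ j,
    {in C, forall A, #|A| = j.+1} & {in H, forall B, exists2 A, A \in C & A \subset B}].
Proof.
move=> HU; elim: j => [|j IH] rH.
  exists [set [set x] | x in U]; split=> [|_ /imsetP[x _ ->]|B /HU].
  - by rewrite muln1 leq_imset_card.
  - by rewrite cards1.
  case/pred0Pn => x /= /andP[xB xU]; exists [set x]; last by rewrite sub1set.
  exact: imset_f.
have [|C [Cn Cj CH]] := IH.
  move=> B /rH[rB nB]; split=> // A AB A0 Aj; apply: nB => //; exact: leqW.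
pose good A W := [&& #|W| <= m, [disjoint W & A]
  & [forall B in H, (A \subset B) ==> ~~ [disjoint B & W]]].
(* The default [set0] keeps [#|w A| <= m] for every [A]. *)
pose w A := odflt set0 [pick W | good A W].
exists (\bigcup_(A in C) [set x |: A | x in w A & x \notin A]); split.
- apply: leq_trans (card_bigcup_le _ _ _) _.
  rewrite expnSr mulnA; apply: leq_trans (leq_mul Cn (leqnn m)).
  rewrite -sum_nat_const; apply: leq_sum => A _.
  apply: leq_trans (leq_imset_card _ _) _.
  apply: (@leq_trans #|w A|); last first.
    by rewrite /w; case: pickP => [W /and3P[]//|_]; rewrite cards0.
  by apply: subset_leq_card; apply/subsetP => x; rewrite inE => /andP[].
- move=> B /bigcupP[A AC /imsetP[x]]; rewrite inE => /andP[_ xA] ->.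
  by rewrite cardsU1 xA (Cj _ AC).
move=> B BH; have [A AC AB] := CH B BH; have [rB nB] := rH B BH.
have nA : ~~ rob A by apply: nB; rewrite ?(Cj _ AC) // -card_gt0 (Cj _ AC).
have [W [Wm WA WB]] := not_robust_witness nA.
have : good A (w A).
  rewrite /w; case: pickP => // /(_ W)/negbT/negP[]; rewrite /good Wm WA /=.
  by apply/forall_inP => B' B'H; apply/implyP => AB'; apply: WB (rH _ B'H).1 AB'.
case/and3P => _ wA /forall_inP/(_ B BH); rewrite AB /= => /pred0Pn[x /= /andP[xB xw]].
exists (x |: A); last by rewrite subUset sub1set xB.
apply/bigcupP; exists A => //; apply: imset_f; rewrite inE xw.
by have /pred0P/(_ x) := wA; rewrite /= xw /= => ->.
Qed.

(** Branching [j] times from a transversal leaves at most [h * (s - #|robust_vertices|) * m ^ j]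
    sets of size [j.+1]; each edge counted contains one of them. *)
Lemma card_light_edges h j d (H : {set {set V}}) : h <= k ->
  {in H, forall B, [/\ rob B, B != set0, #|B| <= h & [disjoint B & robust_vertices]]} ->
  {in H, forall B A, A \subset B -> A != set0 -> #|A| <= j -> ~~ rob A} ->
  (forall A, #|A| = j.+1 -> degree F A <= d) ->
  #|[set E in F | [exists B in H, B \subset E]]|
    <= (s - #|robust_vertices|) * (h * m ^ j * d).
Proof.
move=> hk rH nH dF; have [U Uh HU] := robust_transversal hk rH.
have [|C [Cn Cj CH]] := @branching H U j HU.
  by move=> B BH; split; [case: (rH B BH) | apply: nH].
have: [set E in F | [exists B in H, B \subset E]] \subset
    \bigcup_(A in C) [set E in F | A \subset E].
  apply/subsetP => E; rewrite inE => /andP[EF /exists_inP[B BH BE]].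
  have [A AC AB] := CH B BH; apply/bigcupP; exists A => //.
  by rewrite inE EF (subset_trans AB BE).
move/subset_leq_card/leq_trans; apply.
apply: leq_trans (card_bigcup_le _ _ _) _.
apply: (@leq_trans (#|C| * d)).
  by rewrite -sum_nat_const; apply: leq_sum => A AC; apply/dF/Cj.
rewrite !mulnA leq_mul2r (leq_trans Cn) ?orbT // leq_mul2r mulnC.
by rewrite mulnC [_ * h]mulnC Uh orbT.
Qed.

(* Split the edges by a smallest robust subset B. Those with #|B| = i.+1 <= t are
   counted through the sets B, which have a transversal of size
   i.+1 * (s - #|robust_vertices|); for the others it has k * (s - ...) vertices. *)
Lemma card_edges_off_robust_vertices t (D : nat -> nat) : t < k ->
  (forall A, 1 < #|A| <= t.+1 -> degree F A <= D #|A|) -> 0 < t ->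
  #|[set E in F | [disjoint E & robust_vertices]]| <=
    (s - #|robust_vertices|) *
      (\sum_(1 <= i < t) i.+1 * m ^ i * D i.+1 + k * m ^ t * D t.+1).
Proof.
move=> tk dF t_gt0; set F' := [set E in F | _].
(* The cut-off [j] has two uses: [j = #|B| - 1] expresses minimality among nonempty robust sets, and
   [j = t] excludes small robust subsets of an edge. *)
pose minimal B j := [&& rob B, B != set0, [disjoint B & robust_vertices] &
  [forall A : {set V}, [&& A \subset B, A != set0 & #|A| <= j] ==> ~~ rob A]].
pose Hs i := [set B : {set V} | (#|B| == i.+1) && minimal B i].
pose Hd := [set E in F | minimal E t].
pose up (H : {set {set V}}) := [set E in F | [exists B in H, B \subset E]].
have minP B j : minimal B j -> [/\ rob B, B != set0, [disjoint B & robust_vertices] &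
    forall A, A \subset B -> A != set0 -> #|A| <= j -> ~~ rob A].
  case/and4P => rB B0 dB /forallP nB; split=> // A AB A0 Aj.
  by have := nB A; rewrite AB A0 Aj.
have sF' : F' \subset \bigcup_(1 <= i < t) up (Hs i) :|: up Hd.
  apply/subsetP => E; rewrite !inE => /andP[EF dE].
  have E0 : E != set0 by rewrite -card_gt0 (Fk EF).
  pose P B := [&& B \subset E, B != set0 & rob B].
  have PE : P E by rewrite /P subxx E0; apply: robust_edge.
  case: (arg_minnP (fun B => #|B|) PE) => B /and3P[BE B0 rB] Bmin.
  have dB : [disjoint B & robust_vertices] by apply: disjointWl dE.
  have nB A : A \subset E -> A != set0 -> #|A| < #|B| -> ~~ rob A.
    move=> AE A0; rewrite ltnNge; apply: contra => rA; apply: Bmin.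
    by rewrite /P AE A0.
  have B_gt0 : 0 < #|B| by rewrite card_gt0.
  (* A robust singleton would be a robust vertex in [E]; so sizes start at 2 and the index
     [#|B| - 1] at 1. *)
  have Bn1 : #|B| != 1.
    apply/eqP => B1; have /cards1P[x Bx] : #|B| == 1 by rewrite B1.
    by move: dB; rewrite Bx disjoints1 inE -Bx rB.
  have [Bt|Bt] := leqP #|B| t; last first.
    apply/orP; right; rewrite EF; apply/exists_inP; exists E => //.
    rewrite inE EF /minimal (robust_edge m EF : rob E) E0 dE /=.
    apply/forallP => A; apply/implyP => /and3P[AE A0 At]; apply: nB => //.
    exact: leq_ltn_trans Bt.
  apply/orP; left; rewrite (big_rem #|B|.-1) /=; last first.
    rewrite mem_index_iota; case: #|B| B_gt0 Bn1 Bt => [|[|b]] //=.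
  rewrite !inE EF /=; apply/orP; left; apply/exists_inP; exists B => //.
  rewrite inE prednK // eqxx /minimal rB B0 dB /=.
  apply/forallP => A; apply/implyP => /and3P[AB A0 At]; apply: nB => //.
    exact: subset_trans BE.
  by rewrite -(prednK B_gt0) ltnS.
apply: leq_trans (subset_leq_card sF') _.
apply: leq_trans (leq_card_setU _ _) _; rewrite mulnDr; apply: leq_add.
  apply: leq_trans (card_bigcup_le _ _ _) _; rewrite big_distrr /=.
  rewrite !big_nat; apply: leq_sum => i /andP[i1 it].
  apply: card_light_edges => [|B|B|A Ai].
  - by apply: leq_trans it (ltnW tk).
  - by rewrite inE => /andP[/eqP-> /minP[]].
  - by rewrite inE => /andP[_ /minP[]].
  - by rewrite -Ai dF // Ai ltnS i1 /= ltnS ltnW.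
apply: card_light_edges => // [B|B|A Ai].
- by rewrite inE => /andP[BF /minP[]]; rewrite (Fk BF).
- by rewrite inE => /andP[_ /minP[]].
- by rewrite -Ai dF // Ai leqnn ltnS t_gt0.
Qed.
End BoundedMatching.

(** * Enlarging the set of robust vertices, and the deterministic comparison *)

(** An edge through [x] that already meets [T] contains a pair [[set x; y]] with [y] in [T]; there
    are at most [#|T| * d] such edges. *)
Lemma card_edges_meeting_add G T x d : x \notin T ->
  (forall A, #|A| = 2 -> degree G A <= d) ->
  #|edges_meeting G T| + degree G [set x]
    <= #|edges_meeting G (x |: T)| + #|T| * d.
Proof.
move=> xT dG.
pose P := [set E in G | (x \in E) && [disjoint E & T]].
have deg_x : degree G [set x] <= #|P| + #|T| * d.
  have: [set E in G | [set x] \subset E] \subset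
      P :|: \bigcup_(y in T) [set E in G | [set x; y] \subset E].
    apply/subsetP => E; rewrite !inE sub1set => /andP[EG xE]; rewrite EG xE /=.
    case: (boolP [disjoint E & T]) => //= /pred0Pn[y /= /andP[yE yT]].
    by apply/bigcupP; exists y => //; rewrite inE subUset !sub1set EG xE yE.
  move/subset_leq_card/leq_trans; apply.
  apply: leq_trans (leq_card_setU _ _) _; rewrite leq_add2l.
  apply: leq_trans (card_bigcup_le _ _ _) _.
  rewrite -sum_nat_const; apply: leq_sum => y yT; apply: dG.
  by rewrite cards2; case: eqP yT xT => // -> ->.
apply: leq_trans (_ : #|edges_meeting G T| + (#|P| + #|T| * d) <= _).
  by rewrite leq_add2l.
rewrite addnA leq_add2r.
have dP : [disjoint edges_meeting G T & P].
  rewrite -setI_eq0; apply/eqP/setP => E; rewrite !inE.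
  by rewrite setI_eq0; case: [disjoint E & T]; rewrite ?andbF.
have [_] := leq_card_setU (edges_meeting G T) P; rewrite dP => /eqP <-.
apply: subset_leq_card; apply/subsetP => E; rewrite !inE.
case/orP => /andP[-> ] /=.
  by apply: contra; rewrite -!subset0; apply/subset_trans/setIS/subsetUr.
by case/andP=> xE _; apply/set0Pn; exists x; rewrite !inE xE eqxx.
Qed.

(** Vertices are added one by one, in any order: fewer than [s] earlier ones share at most [s * d]
    edges with the new one, which leaves at least [K.+1] new edges. *)
Lemma exists_edges_meeting_ge G d K s T : s <= #|V| -> #|T| <= s ->
  (forall A, #|A| = 2 -> degree G A <= d) ->
  (forall x, K + s * d < degree G [set x]) ->
  exists S, [/\ #|S| = s, T \subset S &
    #|edges_meeting G T| + (s - #|T|) * K.+1 <= #|edges_meeting G S|].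
Proof.
move=> sV Ts dG dG1; move: {2}(s - #|T|) (erefl (s - #|T|)) => r.
elim: r T Ts => [|r IH] T Ts sT.
  exists T; split=> //; last by rewrite sT addn0.
  by apply/eqP; rewrite eqn_leq Ts -subn_eq0 sT.
have ltTs : #|T| < s by rewrite -subn_gt0 sT.
have /subsetPn[x _ xT] : ~~ ([set: V] \subset T).
  apply/negP => /subset_leq_card.
  by rewrite cardsT leqNgt (leq_trans ltTs).
have [||S [Ss TS leS]] := IH (x |: T); rewrite ?cardsU1 ?xT //.
  by rewrite add1n subnS sT.
exists S; split=> //; first exact: subset_trans (subsetUr _ _) TS.
apply: leq_trans leS; rewrite sT cardsU1 xT add1n subnS sT /= mulSn addnA.
rewrite leq_add2r -(leq_add2r (#|T| * d)).
apply: leq_trans (card_edges_meeting_add xT dG).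
rewrite -addnA leq_add2l; apply: leq_trans (dG1 x).
by rewrite addSn ltnS leq_add2l leq_mul2r (ltnW ltTs) orbT.
Qed.

(** At most [m * d] edges through [x] meet a set of [m] other vertices, so one of them avoids it. *)
Lemma robust_vertex G S m d x : x \in S ->
  (forall A, #|A| = 2 -> degree G A <= d) -> m * d < degree G [set x] ->
  robust (edges_meeting G S) m [set x].
Proof.
move=> xS dG ltd; apply/robustP => W Wm; rewrite disjoint_sym disjoints1 => xW.
have : ~~ ([set E in G | [set x] \subset E] \subset
    \bigcup_(y in W) [set E in G | [set x; y] \subset E]).
  apply/negP => /subset_leq_card; rewrite leqNgt => /negP; apply.
  apply: leq_ltn_trans ltd; apply: leq_trans (card_bigcup_le _ _ _) _.
  apply: leq_trans (leq_mul Wm (leqnn d)).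
  rewrite -sum_nat_const; apply: leq_sum => y yW; apply: dG.
  by rewrite cards2; case: eqP yW xW => // -> ->.
case/subsetPn => E; rewrite inE => /andP[EG xE] nE; exists E; split=> //.
  rewrite inE EG; apply/set0Pn; exists x; rewrite inE xS andbT.
  by rewrite sub1set in xE.
rewrite disjoint_subset; apply/subsetP => y yE; rewrite inE.
apply: contra nE => yW; apply/bigcupP; exists y => //.
by rewrite inE EG subUset xE sub1set.
Qed.

(** Only degree bounds on [G] enter, so randomness is needed for these alone; [F] inherits the upper
    bounds. *)
Lemma nontrivial_lt_edges_meeting G F k s t (D : nat -> nat) :
  1 < t < k -> s <= #|V| -> {in G, forall E, #|E| = k} ->
  (forall A, 1 < #|A| <= t.+1 -> degree G A <= D #|A|) ->
  (forall x, \sum_(1 <= i < t) i.+1 * (k * s) ^ i * D i.+1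
      + k * (k * s) ^ t * D t.+1 + s * D 2 < degree G [set x]) ->
  F \subset G -> nontrivial F -> matching_number F <= s ->
  exists2 S : {set V}, #|S| = s & #|F| < #|edges_meeting G S|.
Proof.
move=> /andP[t1 tk] sV Gk dG dG1 FG ntF nuF.
have k_gt0 : 0 < k by apply: leq_trans tk.
have Fk : {in F, forall E, #|E| = k} by move=> E /(subsetP FG)/Gk.
have dF A : 1 < #|A| <= t.+1 -> degree F A <= D #|A|.
  move=> /dG; apply: leq_trans; apply: subset_leq_card; apply/subsetP => E.
  by rewrite !inE => /andP[/(subsetP FG)-> ->].
have dG2 A : #|A| = 2 -> degree G A <= D 2.
  by move=> A2; rewrite -A2 dG // A2 /= ltnS ltnW.
set K := (\sum_(1 <= i < t) _ + _) in dG1.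
case: (boolP [exists T : {set V}, is_cover F T && (#|T| <= s)]).
  case/existsP => T /andP[cT Ts].
  have [S [Ss TS _]] := exists_edges_meeting_ge sV Ts dG2 dG1.
  exists S => //; rewrite ltnNge; apply/negP => le_SF.
  have sFS : F \subset edges_meeting G S.
    apply/subsetP => E EF; rewrite inE (subsetP FG) //=.
    apply: contra (forall_inP cT E EF); rewrite -!subset0.
    exact/subset_trans/setIS.
  have eF : F = edges_meeting G S by apply/eqP; rewrite eqEcard sFS.
  case/eqP: ntF; apply/eqP; rewrite eqn_leq.
  rewrite (matching_number_le_cover_number cT) /=.
  apply: leq_trans (leq_trans (cover_number_le cT) Ts) _.
  have [||||Ms [MF dM szM]] := @robust_matching F (k * s) k
    [seq [set x] | x in S] [::] Fk.
  - move=> B /mapP[x]; rewrite mem_enum => xS ->; rewrite cards1 k_gt0 andbT.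
    rewrite eF; apply: robust_vertex dG2 _ => //.
    (* The summand [i = 1] of [K] already dominates [k * s * D 2], the degree threshold for
       robustness of [x]. *)
    apply: leq_ltn_trans (dG1 x); rewrite /K -addnA.
    rewrite big_ltn //= expn1 -!addnA; apply: leq_trans (leq_addr _ _).
    by rewrite -[X in _ <= X]mulnA leq_pmull.
  - by [].
  - by rewrite cats0 pairwise_disj_set1.
  - by rewrite size_map -cardE Ss addn0 leq_mul2l leq_pred orbT.
  have <- : size Ms = s by rewrite szM size_map -cardE Ss addn0.
  apply: size_le_matching_number => // E /MF EF; split=> //.
  by rewrite -card_gt0 Fk.
rewrite negb_exists => /forallP ncov.
pose T := robust_vertices F k s.
have Ts : #|T| <= s by apply: card_robust_vertices_le.
have [E EF dE] : exists2 E, E \in F & [disjoint E & T].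
  have := ncov T; rewrite Ts andbT => /forall_inPn[E EF].
  by rewrite negbK setI_eq0; exists E.
(* The edge [E] is itself a robust set disjoint from [T], so it takes one of the [s] places. *)
have ltTs : #|T| < s.
  have := @robust_family_card F k s k_gt0 Fk nuF [set E].
  rewrite cards1 add1n; apply=> [|B].
    by apply/trivIsetP => A B /set1P-> /set1P->; rewrite eqxx.
  by move=> /set1P->; rewrite robust_edge // (Fk E).
have [S [Ss TS leS]] := exists_edges_meeting_ge sV Ts dG2 dG1.
exists S => //; apply: leq_trans leS; rewrite mulnS.
have := card_edges_off_robust_vertices k_gt0 Fk nuF tk dF (ltnW t1).
rewrite -/K -/T => leF'.
have : #|F| <= #|edges_meeting G T| + (s - #|T|) * K.
  apply: leq_trans (leq_add (leqnn _) leF').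
  rewrite -(cardsID [set E in F | [disjoint E & T]]) addnC.
  apply: leq_add; apply: subset_leq_card; apply/subsetP => E'; rewrite !inE.
    by rewrite setI_eq0 => /andP[+ E'F]; rewrite E'F (subsetP FG).
  by case/andP.
(* Strictness: at least one vertex is added, and each gains [K.+1] against a loss of [K]. *)
move/leq_ltn_trans; apply; rewrite [X in _ < _ + X]addnC addnA -{1}[_ + _ * K]addn0.
by rewrite ltn_add2l subn_gt0.
Qed.
End RobustSets.

Import Order.TTheory GRing.Theory Num.Theory.
Local Open Scope ring_scope.

(** * Exponential moments in the random hypergraph *)

Lemma card_complete_superset n k (A : {set 'I_n}) : (#|A| <= k)%N ->
  #|[set E in complete_hypergraph 'I_n k | A \subset E]|
    = 'C(n - #|A|, k - #|A|).
Proof.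
move=> Ak; have <- : #|~: A| = (n - #|A|)%N by rewrite cardsCs setCK card_ord.
rewrite -cards_draws; set X := [set B : {set 'I_n} | B \subset _ & _].
have dX B : B \in X -> [disjoint B & A].
  by rewrite inE -disjoints_subset => /andP[].
have injU : {in X &, injective (fun B => B :|: A)}.
  move=> B C /dX; rewrite -setI_eq0 => /eqP BA /dX.
  rewrite -setI_eq0 => /eqP CA /(congr1 (fun D => D :\: A)).
  rewrite !setDUl !setDv !setU0.
  by move: (setID B A) (setID C A); rewrite BA CA !set0U => -> ->.
rewrite -(card_in_imset injU); congr #|pred_of_set _|; apply/setP => E.
apply/idP/imsetP => [|[B BX ->]].
  rewrite !inE => /andP[/eqP Ek AE]; exists (E :\: A); last first.
    by rewrite -{1}(setID E A) (setIidPr AE) setUC.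
  by rewrite inE subsetDr cardsD (setIidPr AE) Ek eqxx.
have dB := dX B BX; move: BX; rewrite !inE subsetUr andbT => /andP[_ /eqP Bk].
by have [_] := leq_card_setU B A; rewrite dB => /eqP->; rewrite Bk subnK.
Qed.

(** Turns a degree into [#|U :&: G|] for a fixed [U], the form used in the tail bounds. *)
Lemma degree_complete n k (G : {set {set 'I_n}}) (A : {set 'I_n}) :
  G \subset complete_hypergraph 'I_n k ->
  degree G A = #|[set E in complete_hypergraph 'I_n k | A \subset E] :&: G|.
Proof.
move=> /subsetP GH; congr #|pred_of_set _|; apply/setP => E; rewrite 4!inE andbC.
by case: (boolP (E \in G)) => [/GH|]; rewrite ?inE ?andbF // => ->; rewrite !andbT.
Qed.

Section KpProbability.
Variables (R : numDomainType) (n k : nat) (p : R).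
Hypothesis p01 : 0 <= p <= 1.
Let H := complete_hypergraph 'I_n k.
Implicit Types (G U : {set {set 'I_n}}) (A B : pred {set {set 'I_n}}).

Lemma Kp_weight_ge0 G : 0 <= Kp_weight k p G.
Proof.
by case/andP: p01 => p0 p1; apply: prodr_ge0 => E _; case: ifP; rewrite ?subr_ge0.
Qed.

Lemma Kp_prob_predC A : Kp_prob k p A = 1 - Kp_prob k p (predC A).
Proof.
rewrite -(Kp_prob_total n k p) /Kp_prob.
rewrite [X in _ = X - _](bigID (fun G => A G)) /=.
under [X in X + _ - _]eq_bigl do rewrite andbT.
under [X in _ + X - _]eq_bigl do rewrite andbT.
by rewrite addrK.
Qed.

Lemma Kp_prob_ge0 A : 0 <= Kp_prob k p A.
Proof. by apply: sumr_ge0 => G _; apply: Kp_weight_ge0. Qed.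

Lemma Kp_prob_le1 A : Kp_prob k p A <= 1.
Proof. by rewrite Kp_prob_predC gerBl Kp_prob_ge0. Qed.

Lemma Kp_prob_union (I : finType) (Q : pred I) A (B : I -> pred {set {set 'I_n}}) :
  (forall G, G \subset H -> A G -> exists2 i, Q i & B i G) ->
  Kp_prob k p A <= \sum_(i | Q i) Kp_prob k p (B i).
Proof.
move=> AB; rewrite /Kp_prob.
under [X in _ <= X]eq_bigr do rewrite big_mkcondr /=.
rewrite exchange_big /= big_mkcondr /=; apply: ler_sum => G GH.
case: ifPn => AG; last by apply: sumr_ge0 => i _; case: ifP => // _; apply: Kp_weight_ge0.
have [i Qi Bi] := AB G GH AG; rewrite (bigD1 i) //= Bi lerDl.
by apply: sumr_ge0 => j _; case: ifP => // _; apply: Kp_weight_ge0.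
Qed.

Lemma Kp_prob_le A B : (forall G, G \subset H -> A G -> B G) ->
  Kp_prob k p A <= Kp_prob k p B.
Proof.
move=> AB; have := @Kp_prob_union unit predT A (fun=> B).
by rewrite big_const card_unit /= addr0; apply=> G GH AG; exists tt => //; apply: AB.
Qed.

(** The generating function of a binomial variable: an edge in [U] contributes [1 - p + p * z], any
    other edge 1. *)
Lemma Kp_mgf U (z : R) : U \subset H ->
  \sum_(G : {set {set 'I_n}} | G \subset H) z ^+ #|U :&: G| * Kp_weight k p G
  = (1 + p * (z - 1)) ^+ #|U|.
Proof.
move=> UH.
transitivity (\sum_(G : {set {set 'I_n}} | G \subset H)
    \prod_(E in H) (if E \in G then p * (if E \in U then z else 1) else 1 - p)).
  apply: eq_bigr => G GH; rewrite -prodr_const /Kp_weight.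
  rewrite [X in X * _](_ : _ = \prod_(E in H) (if E \in U :&: G then z else 1)).
    rewrite -big_split /=; apply: eq_bigr => E _; rewrite inE.
    by case: (E \in U); case: (E \in G) => /=; rewrite ?mulr1 ?mul1r // mulrC.
  rewrite -big_mkcondr /=; apply: eq_bigl => E; rewrite !inE.
  by case: (boolP (E \in U)) => [/(subsetP UH)|]; rewrite ?inE ?andbF // => ->.
rewrite sum_subset_prod -prodr_const big_mkcond [RHS]big_mkcond /=.
apply: eq_bigr => E _; case: (boolP (E \in U)) => EU.
  by rewrite (subsetP UH) // mulrBr mulr1 addrCA addrA.
by case: ifP => // _; rewrite mulr1 addrCA subrr addr0.
Qed.

(** Markov's inequality for [c * z ^+ #|U :&: G|], which dominates the indicator of [A]; [z > 1]
    serves upper tails, [z < 1] lower tails. *)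
Lemma Kp_markov U A (c z : R) : U \subset H -> 0 <= c -> 0 <= z ->
  (forall G, A G -> 1 <= c * z ^+ #|U :&: G|) ->
  Kp_prob k p A <= c * (1 + p * (z - 1)) ^+ #|U|.
Proof.
move=> UH c0 z0 Ac; rewrite -Kp_mgf // mulr_sumr /Kp_prob big_mkcondr /=.
apply: ler_sum => G _; rewrite mulrA; case: ifPn => [/Ac AG|_].
  by rewrite ler_peMl ?Kp_weight_ge0.
by rewrite !mulr_ge0 ?exprn_ge0 ?Kp_weight_ge0.
Qed.
End KpProbability.

(** Used to sum the failure bounds of all nonempty vertex sets at once. *)
Lemma sum_nonempty_expr (R : comNzRingType) (n : nat) (x : R) :
  \sum_(A : {set 'I_n} | (0 < #|A|)%N) x ^+ #|A| = (1 + x) ^+ n - 1.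
Proof.
have := sum_subset_prod [set: 'I_n] (fun=> x) (fun=> 1).
rewrite prodr_const cardsT card_ord addrC => <-.
rewrite [in RHS](bigD1 set0) ?sub0set //=.
rewrite [X in X + _ - 1]big1 => [|i _]; last by rewrite inE.
rewrite addrC addKr; apply: eq_big => [A|A _]; first by rewrite subsetT card_gt0.
by rewrite -big_mkcondr -prodr_const; apply: eq_bigl => i; rewrite inE.
Qed.

(** Raising [i] by one multiplies the binomial by [(k - i.+1) / (n - i.+1)], at most [k / n] because
    [k <= n]. *)
Lemma bin_sub_le (R : realFieldType) (n k i : nat) : (i < k <= n)%N ->
  'C(n - i.+1, k - i.+1)%:R <= 'C(n.-1, k.-1)%:R * (k%:R / n%:R) ^+ i :> R.
Proof.
case/andP => ik kn; elim: i ik => [|i IH] ik.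
  by rewrite expr0 mulr1 !subn1.
apply: le_trans (_ : 'C(n - i.+1, k - i.+1)%:R * (k%:R / n%:R) <= _); last first.
  by rewrite exprSr [X in _ <= X]mulrA ler_wpM2r ?divr_ge0 ?ler0n // IH // ltnW.
have n0 : (0 < n)%N by apply: leq_trans kn; apply: leq_trans ik.
rewrite mulrA ler_pdivlMr ?ltr0n // -!natrM ler_nat.
have := mul_bin_diag (n - i.+1) (k - i.+2).
rewrite subnSK // -subnS; move: ('C(n - i.+2, k - i.+2)) 'C(_, _) => a b E.
have ni : (0 < n - i.+1)%N by rewrite subn_gt0 (leq_trans ik).
rewrite -(leq_pmul2l ni) mulnA E -mulnA mulnCA [X in (_ <= X)%N]mulnCA.
rewrite leq_mul2l; apply/orP; right.
by rewrite !mulnBl [(n * k)%N]mulnC leq_sub2l // leq_mul2l kn orbT.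
Qed.

From mathcomp Require Import all_classical all_reals all_analysis.
From mathcomp Require Import ring lra.
Import numFieldNormedType.Exports.

(** From [1 - 1 / 2 <= expR (- (1 / 2))], the square root of e is at most 2. *)
Lemma expR1_le4 (R : realType) : expR 1 <= 4 :> R.
Proof.
have := expR_ge1Dx (- (1 / 2) : R); rewrite expRN => h.
have e0 := expR_gt0 (1 / 2 : R).
have -> : 1 = 1 / 2 + 1 / 2 :> R by field.
rewrite expRD; set e := expR _ in h e0 *.
have e2 : e <= 2.
  have : e * (1 - 1 / 2) <= e * e^-1 by rewrite ler_wpM2l // ltW.
  by rewrite mulfV ?gt_eqF //; lra.
nra.
Qed.

(** * Upper and lower tails of the degrees *)

Section DegreeTails.
Variables (R : realType) (n k : nat) (p : R).
Hypothesis p01 : 0 <= p <= 1.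
Let H := complete_hypergraph 'I_n k.
Implicit Types (U : {set {set 'I_n}}).

(** With [z = e], the bound e - 1 <= 3 makes the moment at most [expR (3 * p * #|U|)], which the
    multiple 3 of the mean cancels. *)
Lemma Kp_upper_tail U (y : R) : U \subset H ->
  Kp_prob k p (fun G => 3 * (p * #|U|%:R) + y < #|U :&: G|%:R) <= expR (- y).
Proof.
case/andP: (p01) => p0 p1 UH; set x := 3 * _ + y.
apply: le_trans.
  apply: (Kp_markov p01 (c := expR (- x)) (z := expR 1) UH);
    rewrite ?expR_ge0 //.
  move=> G xG; rewrite -expRM_natl -expRD mulr1 -[X in X <= _]expR0 ler_expR.
  by rewrite addrC subr_ge0 ltW.
apply: (@le_trans _ _ (expR (- x) * expR (3 * p) ^+ #|U|)).
  rewrite ler_wpM2l ?expR_ge0 // lerXn2r ?nnegrE ?expR_ge0 //.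
    have := expR_ge1Dx (1 : R); nra.
  apply: le_trans (expR_ge1Dx _); rewrite lerD2l mulrC ler_wpM2r //.
  have := expR1_le4 R; lra.
rewrite -expRM_natl -expRD ler_expR /x; lra.
Qed.

(** With [z = 1 / e <= 1 / 2], the exponent is 2/5 - 1/2 = -1/10 times the mean. *)
Lemma Kp_lower_tail U : U \subset H ->
  Kp_prob k p (fun G => #|U :&: G|%:R < 2 / 5 * (p * #|U|%:R))
    <= expR (- (p * #|U|%:R / 10)).
Proof.
case/andP: (p01) => p0 p1 UH; set x := 2 / 5 * _.
have z2 : expR (- 1) <= 1 / 2 :> R.
  rewrite expRN div1r lef_pV2 ?posrE ?expR_gt0 //.
  by have := expR_ge1Dx (1 : R); lra.
have z0 := expR_gt0 (- 1 : R).
apply: le_trans.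
  apply: (Kp_markov p01 (c := expR x) (z := expR (- 1)) UH);
    rewrite ?expR_ge0 //.
  move=> G xG; rewrite -expRM_natl -expRD mulrN1 -[X in X <= _]expR0 ler_expR.
  by rewrite subr_ge0 ltW.
apply: (@le_trans _ _ (expR x * expR (- (p / 2)) ^+ #|U|)).
  rewrite ler_wpM2l ?expR_ge0 // lerXn2r ?nnegrE ?expR_ge0 //; first by nra.
  by apply: le_trans (expR_ge1Dx _); rewrite lerD2l; nra.
rewrite -expRM_natl -expRD ler_expR /x; lra.
Qed.
End DegreeTails.


(** * Comparing the degree bounds *)

Lemma sum_geometric_28_le (R : realFieldType) (t : nat) :
  27 * \sum_(1 <= i < t) (1 / 28) ^+ i <= 1 :> R.
Proof.
case: t => [|t]; first by rewrite big_geq // mulr0.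
(* The exact value of the partial sum is what the induction carries. *)
suff : 27 * \sum_(1 <= i < t.+1) (1 / 28) ^+ i <= 1 - (1 / 28) ^+ t :> R.
  by have := exprn_ge0 t (_ : 0 <= 1 / 28 :> R); lra.
elim: t => [|t IH]; first by rewrite big_geq // mulr0 subrr.
rewrite big_nat_recr //= mulrDr exprS; lra.
Qed.

(* Three times the mean of the degree of an i-set, plus the deviation that makes
   the exponential-moment bound at most n^(-2i). *)
Definition degree_bound (R : realType) (n k : nat) (p : R) (i : nat) : R :=
  3 * (p * 'C(n - i, k - i)%:R) + 2 * i%:R * ln n%:R.

Section DegreeBudget.
Variables (R : realType) (n k s t : nat) (p : R).
Let K : R := k%:R.
Let S : R := s%:R.
(** The mean degree of a vertex, the unit of all later estimates. *)
Let q : R := p * 'C(n.-1, k.-1)%:R.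
Let L : R := ln n%:R.
(** [n_get] is the [t]-th power of n >= 56 k^(2+1/t) s, free of real exponents; [n_ge] is its
    weakening without 1/t. *)
Hypotheses (t_gt1 : (1 < t)%N) (tk : (10 * t <= k)%N) (s_gt0 : (0 < s)%N)
  (p_ge0 : 0 <= p)
  (n_ge : 56 * (K ^+ 2 * S) <= n%:R)
  (n_get : 56 ^+ t * (K * (K ^+ 2 * S) ^+ t) <= n%:R ^+ t)
  (q_ge : 8 * (t%:R + 1) * K ^+ t.+1 * S ^+ t * L <= q).

Lemma budget_K_ge : 20 <= K.
Proof.
by rewrite /K (ler_nat R 20); apply: leq_trans tk; rewrite (leq_mul2l 10 2).
Qed.

Lemma budget_S_ge : 1 <= S. Proof. by rewrite ler1n. Qed.

Lemma budget_K_le_n : K <= n%:R.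
Proof. by have := budget_K_ge; have := budget_S_ge; have := n_ge; nra. Qed.

Lemma budget_L_gt0 : 0 < L.
Proof.
by apply: ln_gt0; have := budget_K_ge; have := budget_K_le_n; lra.
Qed.

Lemma budget_mu_le i : (i < k)%N ->
  p * 'C(n - i.+1, k - i.+1)%:R <= q * (K / n%:R) ^+ i.
Proof.
move=> ik; rewrite /q -mulrA ler_wpM2l // bin_sub_le // ik /=.
by have := budget_K_le_n; rewrite ler_nat.
Qed.

(* The loss factor of one branching step: k s extensions, each contained in a
   proportion k / n of the edges. *)
Let a : R := K ^+ 2 * S / n%:R.

Lemma budget_a_ge0 : 0 <= a.
Proof. by rewrite /a divr_ge0 // mulr_ge0 // exprn_ge0. Qed.

Lemma budget_n_gt0 : 0 < n%:R :> R.
Proof. by have := budget_K_ge; have := budget_K_le_n; lra. Qed.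

Lemma budget_a_le : 56 * a <= 1.
Proof. by rewrite /a mulrA ler_pdivrMr ?budget_n_gt0 // mul1r. Qed.

(** Here the exponent 1/t pays: [t] branching steps absorb the extra factor [K] of the
    transversal. *)
Lemma budget_at_le : 56 ^+ t * (K * a ^+ t) <= 1.
Proof.
have nt : 0 < n%:R ^+ t :> R by rewrite exprn_gt0 // budget_n_gt0.
move: n_get; rewrite /a expr_div_n; move: (_ ^+ t) => X hX.
by rewrite !mulrA ler_pdivrMr // mul1r -mulrA.
Qed.

Lemma budget_pow i : (K * S) ^+ i * (K / n%:R) ^+ i = a ^+ i.
Proof. by rewrite -exprMn /a; congr (_ ^+ i); rewrite expr2; lra. Qed.

Lemma budget_q_gt0 : 0 < q.
Proof.
apply: lt_le_trans q_ge; have K0 := budget_K_ge; have S0 := budget_S_ge.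
rewrite !mulr_gt0 ?budget_L_gt0 // ?exprn_gt0 //; try lra.
Qed.

(** The lower bound on [q] splits off [8 * (t + 1) * K ^+ 2 * S], and [K >= 10 * t] makes this at
    least [800 * t ^+ 3]. *)
Lemma budget_M_le : 800 * (t%:R ^+ 3 * ((K * S) ^+ t.-1 * L)) <= q.
Proof.
have K0 := budget_K_ge; have S0 := budget_S_ge; have L0 := budget_L_gt0.
have T0 : 0 <= t%:R :> R by [].
have KT : 10 * t%:R <= K by rewrite -natrM ler_nat.
apply: le_trans q_ge.
have -> : K ^+ t.+1 = K ^+ 2 * K ^+ t.-1 by rewrite -exprD addSn add1n prednK // ltnW.
have -> : S ^+ t = S * S ^+ t.-1 by rewrite -exprS prednK // ltnW.
rewrite exprMn; set M := K ^+ t.-1; set M' := S ^+ t.-1.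
have -> : 8 * (t%:R + 1) * (K ^+ 2 * M) * (S * M') * L =
  (8 * (t%:R + 1) * K ^+ 2 * S) * (M * M' * L) by ring.
rewrite mulrA ler_wpM2r //.
  by rewrite !mulr_ge0 ?exprn_ge0 //; lra.
have h1 : 100 * t%:R ^+ 2 <= K ^+ 2 by rewrite !expr2; nra.
have h2 : t%:R * (100 * t%:R ^+ 2) <= (t%:R + 1) * K ^+ 2.
  by apply: ler_pM => //; rewrite ?mulr_ge0 ?exprn_ge0 //; lra.
have h3 : 0 <= (t%:R + 1) * K ^+ 2 by rewrite mulr_ge0 ?exprn_ge0 //; lra.
have h4 : (t%:R + 1) * K ^+ 2 <= (t%:R + 1) * K ^+ 2 * S by rewrite ler_peMr.
rewrite exprSr; lra.
Qed.

(** 480 = 8 * 3 * 20, from [t >= 2] and [K >= 20]. *)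
Lemma budget_low : 480 * (S * L) <= q.
Proof.
have K0 := budget_K_ge; have S0 := budget_S_ge; have L0 := budget_L_gt0.
have T2 : 2 <= t%:R :> R by rewrite ler_nat.
apply: le_trans q_ge; rewrite mulrA ler_wpM2r //; first exact: ltW.
have K1 : 1 <= K by lra.
have KP : 20 <= K ^+ t.+1 by apply: le_trans K0 (ler_eXnr _ K1).
have SP : S <= S ^+ t by rewrite ler_eXnr // ltnW.
have : 24 * 20 <= 8 * (t%:R + 1) * K ^+ t.+1 by apply: ler_pM => //; lra.
by move=> h; apply: ler_pM => //; lra.
Qed.

(** The fractions of [q] spent are 1/9 + 1/400 on sizes 2 to [t], 3/3136 + 1/4 on size [t.+1], and
    1/300 + 1/120 on overlaps; their sum is below 2/5. *)
Lemma degree_budget :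
  \sum_(1 <= i < t) i.+1%:R * (K * S) ^+ i * degree_bound n k p i.+1
    + K * (K * S) ^+ t * degree_bound n k p t.+1 + S * degree_bound n k p 2
    < 2 / 5 * q.
Proof.
have K0 := budget_K_ge; have S0 := budget_S_ge; have L0 := budget_L_gt0.
have q0 := budget_q_gt0; have a0 := budget_a_ge0; have a1 := budget_a_le.
have KS1 : 1 <= K * S by nra.
have tk' : (t < k)%N by apply: leq_trans tk; rewrite ltn_Pmull // ltnW.
pose M := (K * S) ^+ t.-1 * L.
have M0 : 0 <= M by rewrite mulr_ge0 ?exprn_ge0 //; lra.
have sum1 : \sum_(1 <= i < t) i.+1%:R * (K * S) ^+ i * degree_bound n k p i.+1
   <= \sum_(1 <= i < t) (3 * q * (1 / 28) ^+ i + 2 * t%:R ^+ 2 * M).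
  rewrite !big_nat; apply: ler_sum => i /andP[i1 it].
  have := budget_mu_le (ltn_trans it tk'); rewrite /degree_bound -/L.
  set mu := p * _ => mu_le; rewrite mulrDr; apply: lerD.
    have h1 : i.+1%:R * (K * S) ^+ i * (3 * mu) <= 3 * q * (i.+1%:R * a ^+ i).
      rewrite -budget_pow.
      have : 0 <= i.+1%:R * (K * S) ^+ i by rewrite mulr_ge0 ?exprn_ge0 //; lra.
      set y := (K * S) ^+ i; set z := (K / _) ^+ i in mu_le * => y0.
      have := ler_wpM2l y0 mu_le; lra.
    apply: le_trans h1 _; rewrite ler_pM2l; last by lra.
    (* As [i.+1 <= 2 ^ i], the ratio becomes [2 * a <= 1 / 28]. *)
    apply: (@le_trans _ _ (2 ^+ i * a ^+ i)).
      by rewrite ler_wpM2r ?exprn_ge0 // -natrX ler_nat ltn_expl.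
    by rewrite -exprMn lerXn2r ?nnegrE //; lra.
  have -> : i.+1%:R * (K * S) ^+ i * (2 * i.+1%:R * L)
    = 2 * (i.+1%:R ^+ 2 * ((K * S) ^+ i * L)) by ring.
  rewrite -mulrA ler_pM2l //; apply: ler_pM.
  - by rewrite exprn_ge0.
  - by rewrite mulr_ge0 ?exprn_ge0 //; lra.
  - by rewrite lerXn2r ?nnegrE // ler_nat.
  - rewrite /M ler_wpM2r //; first exact: ltW.
    by rewrite ler_weXn2l // -ltnS prednK // ltnW.
have sum2 : \sum_(1 <= i < t) (3 * q * (1 / 28) ^+ i + 2 * t%:R ^+ 2 * M)
    <= 1 / 9 * q + q / 400.
  rewrite big_split /= -mulr_sumr sumr_const_nat -[_ *+ _]mulr_natl.
  apply: lerD.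
    have := sum_geometric_28_le R t; set y := \sum_(_ <= _ < _) _ => y1; nra.
  have := budget_M_le; rewrite -/M => hM.
  have : (t - 1)%:R * (2 * t%:R ^+ 2 * M) <= t%:R * (2 * t%:R ^+ 2 * M).
    apply: ler_wpM2r; last by rewrite ler_nat leq_subr.
    by apply: mulr_ge0 M0; rewrite mulr_ge0 ?exprn_ge0.
  by move: hM; rewrite exprS; lra.
have deep : K * (K * S) ^+ t * degree_bound n k p t.+1 <= 3 * q / 3136 + q / 4.
  have := budget_mu_le tk'; rewrite /degree_bound -/L.
  set mu := p * _ => mu_le; rewrite mulrDr; apply: lerD; last first.
    (* The logarithmic part is exactly a quarter of the assumed lower bound on [q]. *)
    have -> : K * (K * S) ^+ t * (2 * t.+1%:R * L) =
      (8 * (t%:R + 1) * K ^+ t.+1 * S ^+ t * L) / 4.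
      by rewrite -natr1 exprMn exprS; field.
    by rewrite ler_pM2r //; lra.
  have h1 : K * (K * S) ^+ t * (3 * mu) <= 3 * q * (K * a ^+ t).
    rewrite -budget_pow.
    have : 0 <= K * (K * S) ^+ t by rewrite mulr_ge0 ?exprn_ge0 //; lra.
    set y := (K * S) ^+ t; set z := (K / _) ^+ t in mu_le * => y0.
    have := ler_wpM2l y0 mu_le; lra.
  apply: le_trans h1 _; rewrite ler_pM2l; last by lra.
  have b0 : 0 <= K * a ^+ t by rewrite mulr_ge0 ?exprn_ge0.
  have : 56 ^+ 2 * (K * a ^+ t) <= 1.
    apply: le_trans budget_at_le; rewrite ler_wpM2r // ler_weXn2l //; lra.
  by rewrite expr2; lra.
have two : S * degree_bound n k p 2 <= q / 300 + q / 120.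
  have := @budget_mu_le 1 (leq_trans t_gt1 (ltnW tk')).
  rewrite expr1 /degree_bound -/L; set mu := p * _ => mu_le.
  have h1 : S * (3 * mu) <= q / 300.
    (* With [a <= 1 / 56] and [K >= 20], this gives [S * K / n <= 1 / 1120]. *)
    have : K * (S * (K / n%:R)) = a by rewrite /a; lra.
    set z := K / n%:R in mu_le * => ez.
    have : S * mu <= q * (S * z) by have := ler_wpM2l (le_trans ler01 S0) mu_le; lra.
    have : 20 * (S * z) <= K * (S * z).
      by rewrite ler_wpM2r // mulr_ge0 ?divr_ge0 //; lra.
    have : 1120 * (S * z) <= 1 -> q * (1120 * (S * z)) <= q.
      by move=> ?; rewrite ler_piMr // ltW.
    lra.
  have := budget_low; lra.
lra.
Qed.
End DegreeBudget.

(** * Union bound over vertex sets with an exceptional degree *)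

(** A nonempty [A] is bad with probability at most n^(-2|A|); summing over [A] gives (1 + n^(-2))^n
    - 1, at most [expR (n^-1) - 1]. *)
Lemma Kp_prob_nontrivial_small_ge (R : realType) (n k s t : nat) (p : R) :
  (1 < t)%N -> (10 * t <= k)%N -> (0 < s)%N -> 0 <= p <= 1 ->
  56 * (k%:R ^+ 2 * s%:R) <= n%:R :> R ->
  56 ^+ t * (k%:R * (k%:R ^+ 2 * s%:R) ^+ t) <= n%:R ^+ t :> R ->
  8 * (t%:R + 1) * k%:R ^+ t.+1 * s%:R ^+ t * ln n%:R
    <= p * 'C(n.-1, k.-1)%:R ->
  2 - expR (n%:R^-1) <= Kp_prob k p (fun G : {set {set 'I_n}} =>
    [forall F : {set {set 'I_n}},
      [&& F \subset G, nontrivial F & (matching_number F <= s)%N] ==>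
      [exists S : {set 'I_n},
        (#|S| == s) && (#|F| < #|edges_meeting G S|)%N]]).
Proof.
move=> t1 tk s0 p01 n_ge n_get q_ge; set ev := (fun G => _).
have [p0 p1] := andP p01.
have n0 := budget_n_gt0 t1 tk s0 n_ge.
have L0 := budget_L_gt0 t1 tk s0 n_ge.
have K0 := @budget_K_ge R _ _ t1 tk; have S0 := budget_S_ge R s0.
have kn : (k <= n)%N by have := budget_K_le_n t1 tk s0 n_ge; rewrite ler_nat.
have tk' : (t < k)%N by apply: leq_trans tk; rewrite ltn_Pmull // ltnW.
have budget := degree_budget t1 tk s0 p0 n_ge n_get q_ge.
have low := budget_low t1 tk s0 n_ge q_ge.
set q := p * _ in budget low q_ge; pose X : R := expR (- (2 * ln n%:R)).
pose D i := degree_bound n k p i.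
have D_ge0 i : 0 <= D i.
  by rewrite /D /degree_bound addr_ge0 // ?mulr_ge0 // ltW.
pose bad (A : {set 'I_n}) G := ((1 < #|A| <= t.+1)%N && (D #|A| < (degree G A)%:R))
  || ((#|A| == 1)%N && ((degree G A)%:R < 2 / 5 * q)).
suff : Kp_prob k p (predC ev) <= expR n%:R^-1 - 1.
  by rewrite (Kp_prob_predC k p ev); lra.
have bad_le (A : {set 'I_n}) : (0 < #|A|)%N -> Kp_prob k p (bad A) <= X ^+ #|A|.
  move=> A0; pose U := [set E in complete_hypergraph 'I_n k | A \subset E]%SET.
  have UH : U \subset complete_hypergraph 'I_n k.
    by apply/fintype.subsetP => E; rewrite inE => /andP[].
  have XE i : X ^+ i = expR (- (2 * i%:R * ln n%:R)).
    by rewrite /X -expRM_natl; congr expR; lra.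
  have [A1|A1] := eqVneq #|A| 1%N.
    apply: le_trans (_ : expR (- (p * #|U|%:R / 10)) <= _).
      apply: le_trans (Kp_lower_tail p01 UH); apply: Kp_prob_le => // G GH.
      rewrite /bad A1 /= -(degree_complete _ GH) card_complete_superset ?A1 //.
        by rewrite !subn1.
      exact: leq_ltn_trans tk'.
    rewrite XE A1 ler_expR lerN2 card_complete_superset ?A1; last first.
      exact: leq_ltn_trans tk'.
    (* [low] gives [q / 10 >= 48 * s * ln n], above the required [2 * ln n]. *)
    rewrite !subn1 -/q; nra.
  have [At|At] := leqP #|A| t.+1; last first.
    apply: le_trans (_ : 0 <= _); last by rewrite exprn_ge0 ?expR_ge0.
    rewrite /Kp_prob big1 // => G /andP[_].
    by rewrite /bad [(_ <= t.+1)%N]leqNgt At andbF (negbTE A1).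
  rewrite XE; apply: le_trans (Kp_upper_tail p01 _ UH).
  apply: Kp_prob_le => // G GH; rewrite /bad (negbTE A1) orbF => /andP[_].
  by rewrite -(degree_complete _ GH) card_complete_superset // (leq_trans At).
apply: le_trans (_ : \sum_(A : {set 'I_n} | (0 < #|A|)%N) Kp_prob k p (bad A) <= _).
  apply: Kp_prob_union => // G GH /= nev.
  have [|nbad] := boolP [exists A : {set 'I_n}, (0 < #|A|)%N && bad A G].
    by case/existsP => A /andP[A0 badA]; exists A.
  case/negP: nev; apply/forallP => F; apply/implyP => /and3P[FG ntF nuF].
  (* Degrees are natural numbers, so the real bounds [D] may be truncated. *)
  have [||||x|S Ss ltS] := @nontrivial_lt_edges_meeting _ G F k s t
     (fun i => Num.truncn (D i)) _ _ _ _ _ FG ntF nuF.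
  - by rewrite t1.
  - rewrite card_ord -(ler_nat R).
    have : s%:R <= k%:R ^+ 2 * s%:R :> R by rewrite ler_peMl // exprn_ege1 //; lra.
    by move: n_ge; lra.
  - by move=> E /(fintype.subsetP GH); rewrite inE => /eqP.
  - move=> A At; rewrite truncn_ge_nat // leNgt; apply: contra nbad => ltA.
    by apply/existsP; exists A; rewrite /bad At ltA (ltn_trans _ (andP At).1).
  - rewrite -(ltr_nat R).
    apply: lt_le_trans (_ : 2 / 5 * q <= _); last first.
      rewrite leNgt; apply: contra nbad => ltx; apply/existsP.
      by exists [set x]%SET; rewrite /bad cards1 ltx orbT.
    apply: le_lt_trans budget; rewrite !natrD natr_sum !natrM !natrX.
    have tD i : (Num.truncn (D i))%:R <= D i by rewrite truncn_le.
    apply: lerD; last by rewrite ler_wpM2l.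
    apply: lerD; last first.
      by rewrite natrM; apply: ler_wpM2l.
    apply: ler_sum => i _; rewrite !natrM natrX natrM.
    by apply: ler_wpM2l.
  by apply/existsP; exists S; rewrite Ss eqxx.
apply: le_trans (_ : (1 + X) ^+ n - 1 <= _).
  by rewrite -sum_nonempty_expr; apply: ler_sum.
rewrite lerD2r; apply: le_trans (_ : expR X ^+ n <= _).
  by rewrite lerXn2r ?nnegrE ?expR_ge0 ?expR_ge1Dx // addr_ge0 ?expR_ge0.
rewrite -expRM_natl ler_expR /X expRN expRM_natl lnK ?posrE //.
by rewrite expr2 invfM mulrA mulfV ?mul1r // gt_eqF.
Qed.

(** * Passage to the limit *)

Local Open Scope classical_set_scope.
Local Open Scope ring_scope.

Theorem theorem1p4 (R : realType) (t s k : nat -> nat) (p : nat -> R)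
    (ht : forall n : nat, (2 <= t n)%N)
    (htk : (t n)%:R / (k n)%:R @[n --> \oo] --> (0 : R))
    (hs : forall n : nat, (0 < s n)%N)
    (hk : forall n : nat, (0 < k n)%N)
    (hp : \forall n \near \oo,
       8 * ((t n)%:R + 1) * (k n)%:R ^+ (t n).+1 * (s n)%:R ^+ t n * ln n%:R
         / 'C(n.-1, (k n).-1)%:R <= p n <= 1)
    (hn : \forall n \near \oo,
       56 * (k n)%:R `^ (2 + 1 / (t n)%:R) * (s n)%:R <= (n%:R : R)
         <= 56 * (k n)%:R `^ (2 + 1 / ((t n)%:R - 1)) * (s n)%:R) :
  Kp_prob (k n) (p n) (fun G : {set {set 'I_n}} =>
    [forall F : {set {set 'I_n}},
      [&& F \subset G, nontrivial F & (matching_number F <= s n)%N] ==>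
      [exists S : {set 'I_n},
        (#|S| == s n) && (#|F| < #|edges_meeting G S|)%N]])
    @[n --> \oo] --> (1 : R).
Proof.
have htk10 : \forall n \near \oo, (t n)%:R / (k n)%:R < 1 / 10 :> R.
  by apply: (cvgr_lt 0 htk); lra.
apply: (@squeeze_cvgr _ _ _ _ (fun n : nat => 2 - expR n%:R^-1) (fun=> 1)); last 2 first.
- have : (2 - expR n%:R^-1 : R) @[n --> \oo] --> (2 - expR 0 : R).
    apply: cvgB; first exact: cvg_cst.
    apply: continuous_cvg; first exact: continuous_expR.
    (* [cvg_harmonic] concerns 1/(n+1), hence the shift. *)
    rewrite -(cvg_shiftS (fun n : nat => n%:R^-1 : R)) /=; exact: cvg_harmonic.
  by rewrite expR0 (_ : 2 - 1 = 1 :> R) //; lra.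
- exact: cvg_cst.
near=> n.
have tk : (10 * t n <= k n)%N.
  have : (t n)%:R / (k n)%:R < 1 / 10 :> R by near: n.
  rewrite ltr_pdivrMr ?ltr0n // => h; rewrite -(ler_nat R) natrM; lra.
have /andP[n_ge0 _] : 56 * (k n)%:R `^ (2 + 1 / (t n)%:R) * (s n)%:R <= (n%:R : R)
         <= 56 * (k n)%:R `^ (2 + 1 / ((t n)%:R - 1)) * (s n)%:R by near: n.
have /andP[p_ge p_le] : 8 * ((t n)%:R + 1) * (k n)%:R ^+ (t n).+1
    * (s n)%:R ^+ t n * ln n%:R / 'C(n.-1, (k n).-1)%:R <= p n <= 1 by near: n.
have t0 : (t n)%:R != 0 :> R by rewrite pnatr_eq0 -lt0n (leq_trans _ (ht n)).
have K1 : 1 <= (k n)%:R :> R by rewrite ler1n.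
(* The [t]-th root of [k] isolates the real exponent; raising [n_ge1] to the power [t] then turns it
   into a factor [k]. *)
pose x : R := (k n)%:R `^ (1 / (t n)%:R).
have x1 : 1 <= x.
  by rewrite -(powRr0 (k n)%:R) ler_powR // divr_ge0.
have xt : x ^+ t n = (k n)%:R.
  by rewrite /x -powR_mulrn ?powR_ge0 // -powRrM div1r mulVf // powRr1.
have powE : (k n)%:R `^ (2 + 1 / (t n)%:R) = (k n)%:R ^+ 2 * x :> R.
  by rewrite powRD ?powR_mulrn // pnatr_eq0 -lt0n hk implybT.
have KS0 : 0 <= (k n)%:R ^+ 2 * (s n)%:R :> R by rewrite mulr_ge0 ?exprn_ge0.
have n_ge1 : 56 * ((k n)%:R ^+ 2 * (s n)%:R * x) <= n%:R :> R.
  by move: n_ge0; rewrite powE; lra.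
have n_ge : 56 * ((k n)%:R ^+ 2 * (s n)%:R) <= n%:R :> R.
  by apply: le_trans n_ge1; rewrite ler_pM2l // ler_peMr.
have n_get : 56 ^+ t n * ((k n)%:R * ((k n)%:R ^+ 2 * (s n)%:R) ^+ t n)
    <= n%:R ^+ t n :> R.
  rewrite -[X in _ * (X * _)]xt -!exprMn [x * _]mulrC.
  by rewrite lerXn2r ?nnegrE ?mulr_ge0 ?exprn_ge0 //; lra.
have kn := budget_K_le_n (ht n) tk (hs n) n_ge.
have L0 := budget_L_gt0 (ht n) tk (hs n) n_ge.
have C0 : 0 < 'C(n.-1, (k n).-1)%:R :> R.
  rewrite ltr0n bin_gt0 -!subn1 leq_sub2r //; by move: kn; rewrite ler_nat.
have p0 : 0 <= p n.
  apply: le_trans p_ge; apply: divr_ge0 => //; apply: mulr_ge0 (ltW L0) => //.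
have p01 : 0 <= p n <= 1 by rewrite p0.
rewrite Kp_prob_le1 // andbT; apply: (Kp_prob_nontrivial_small_ge (ht n)) => //.
by rewrite -ler_pdivrMr.
Unshelve. all: by end_near.
Qed.
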